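(* Let $A$ and $B$ be 0-1 matrices of sizes $p\times q$ and $q\times r$, respectively, and let $\ell\in[p]$ and $k\in[r]$ be given positive integer parameters. There is a deterministic algorithm which computes a $p\times r$ matrix $D$ approximating every entry of the arithmetic matrix product $C=AB$ within an additive error, namely $|C_{ij}-D_{ij}|$ for all $i\in[p]$, $j\in[r]$, of at most: (1) $2\lambda(A,\ell,\mathrm{row})$, in time $O(pq\ell+pr)$, if $p\ge r$; (2) $2\lambda(B,k,\mathrm{col})$, in time $O(rqk+pr)$, if $p\le r$.
   Context: For a positive integer $r$, $[r]=\{1,\dots,r\}$. The arithmetic matrix product $C=AB$ has entries $C_{ij}=\sum_{h=1}^q A_{ih}B_{hj}$ (computed over the integers). The Hamming distance $\mathrm{ham}(a,b)$ between $a,b\in\{0,1\}^q$ is the number of coordinates in which they differ. For a 0-1 $p\times q$ matrix $A$, $\lambda(A,\ell,\mathrm{row})$ is the minimum, over all sets $T$ of $\ell$ points of $\{0,1\}^q$ (not necessarily rows of $A$), of $\max_{i\in[p]}\min_{u\in T}\mathrm{ham}(A_{i*},u)$, where $A_{i*}$ is the $i$-th row of $A$. For a 0-1 $q\times r$ matrix $B$, $\lambda(B,k,\mathrm{col})$ is the analogous minimum, over all sets of $k$ points of $\{0,1\}^q$, of the maximum Hamming distance from a column of $B$ to its closest point in the set. Running times are in the standard RAM model. *)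

(* Defs.v *)
From Stdlib Require Import ZArith.
From mathcomp Require Import all_boot all_order all_algebra.
Set Implicit Arguments. Unset Strict Implicit. Unset Printing Implicit Defensive.

Definition point (q : nat) := {ffun 'I_q -> bool}.

Definition ham (q : nat) (a b : point q) : nat := #|[set h | a h != b h]|.

Definition rowpt (p q : nat) (A : 'M[bool]_(p, q)) (i : 'I_p) : point q :=
  [ffun h => A i h].
Definition colpt (q r : nat) (B : 'M[bool]_(q, r)) (j : 'I_r) : point q :=
  [ffun h => B h j].

(* max over rows of the distance to the closest of the l points T t
   (the minimum over t < l uses identity q, which is >= every distance). *)
Definition radius_rows (p q l : nat) (A : 'M[bool]_(p, q))
  (T : {ffun 'I_l -> point q}) : nat :=
  \max_(i < p) \big[minn/q]_(t < l) ham (rowpt A i) (T t).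

Definition radius_cols (q r k : nat) (B : 'M[bool]_(q, r))
  (T : {ffun 'I_k -> point q}) : nat :=
  \max_(j < r) \big[minn/q]_(t < k) ham (colpt B j) (T t).

(* lambda(A, l, row): minimum over all choices of l points of {0,1}^q.
   (Radii are <= q, so q is a neutral identity for minn here.) *)
Definition lambda_row (p q : nat) (A : 'M[bool]_(p, q)) (l : nat) : nat :=
  \big[minn/q]_(T : {ffun 'I_l -> point q}) radius_rows A T.

Definition lambda_col (q r : nat) (B : 'M[bool]_(q, r)) (k : nat) : nat :=
  \big[minn/q]_(T : {ffun 'I_k -> point q}) radius_cols B T.

Definition prod_entry (p q r : nat) (A : 'M[bool]_(p, q)) (B : 'M[bool]_(q, r))
  (i : 'I_p) (j : 'I_r) : nat :=
  \sum_(h < q) (A i h : nat) * (B h j : nat).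

(* Memory: Z -> Z.  Unit cost per instruction.  Every value written     *)
(* must have absolute value <= W (word size O(log n) when W = n^O(1)).  *)

Inductive instr :=
| IConst (d : Z) (z : Z)
| IAdd (d a b : Z)
| ISub (d a b : Z)
| IMul (d a b : Z)
| IDiv (d a b : Z)
| ILoad (d a : Z)
| IStore (a s : Z)
| IJle (a : Z) (t : nat)
| IJmp (t : nat)
| IHalt.

Definition upd (m : Z -> Z) (a v : Z) : Z -> Z :=
  fun x => if Z.eqb x a then v else m x.

(* run W P fuel pc m = Some m' iff, starting at pc with memory m, program P
   executes IHalt within fuel steps (the halting step included), never
   writing a value of absolute value > W; m' is the final memory.
   Falling off the program counts as executing IHalt. *)
Fixpoint run (W : Z) (P : seq instr) (fuel : nat) (pc : nat) (m : Z -> Z)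
  : option (Z -> Z) :=
  match fuel with
  | O => None
  | S f =>
    let wr a v := if Z.leb (Z.abs v) W then run W P f (S pc) (upd m a v)
                  else None in
    match nth IHalt P pc with
    | IConst d z => wr d z
    | IAdd d a b => wr d (Z.add (m a) (m b))
    | ISub d a b => wr d (Z.sub (m a) (m b))
    | IMul d a b => wr d (Z.mul (m a) (m b))
    | IDiv d a b => wr d (Z.div (m a) (m b))
    | ILoad d a => wr d (m (m a))
    | IStore a s => wr (m a) (m s)
    | IJle a t => if Z.leb (m a) Z.zero then run W P f t m else run W P f (S pc) m
    | IJmp t => run W P f t m
    | IHalt => Some m
    end
  end.

Definition bitZ (b : bool) : Z := if b then Z.one else Z.zero.

Definition entryZ (p q : nat) (A : 'M[bool]_(p, q)) (i h : nat) : Z :=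
  match (insub i : option 'I_p), (insub h : option 'I_q) with
  | Some i', Some h' => bitZ (A i' h')
  | _, _ => Z.zero
  end.

(* Input layout: M[0]=p, M[1]=q, M[2]=r, M[3]=s (the parameter l or k),
   A_{ih} (0-indexed) at 4 + i*q + h, B_{hj} at 4 + p*q + h*r + j,
   every other cell 0. *)
Definition baseA : Z := Z.of_nat 4.
Definition baseB (p q : nat) : Z := Z.add baseA (Z.of_nat (p * q)).
Definition baseD (p q r : nat) : Z := Z.add (baseB p q) (Z.of_nat (q * r)).

Definition init_mem (p q r : nat) (A : 'M[bool]_(p, q)) (B : 'M[bool]_(q, r))
  (s : nat) : Z -> Z :=
  fun a =>
    if Z.eqb a (Z.of_nat 0) then Z.of_nat p
    else if Z.eqb a (Z.of_nat 1) then Z.of_nat q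
    else if Z.eqb a (Z.of_nat 2) then Z.of_nat r
    else if Z.eqb a (Z.of_nat 3) then Z.of_nat s
    else if Z.leb baseA a && Z.ltb a (baseB p q) then
      let o := Z.to_nat (Z.sub a baseA) in entryZ A (o %/ q) (o %% q)
    else if Z.leb (baseB p q) a && Z.ltb a (baseD p q r) then
      let o := Z.to_nat (Z.sub a (baseB p q)) in entryZ B (o %/ r) (o %% r)
    else Z.zero.

Definition out_entry (p q r : nat) (m : Z -> Z) (i : 'I_p) (j : 'I_r) : Z :=
  m (Z.add (baseD p q r) (Z.of_nat (i * r + j))).

Definition insize (p q r s : nat) : nat := p + q + r + s + p * q + q * r + p * r + 2.

(* Main.v *)
Require Import Defs.
From Stdlib Require Import ZArith Lia.
From mathcomp Require Import all_boot all_order all_algebra.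
From mathcomp Require Import zify.
Set Implicit Arguments. Unset Strict Implicit. Unset Printing Implicit Defensive.

(** Gonzalez's farthest-point traversal picks l rows of A such that, by
    pigeonhole, every row of A is within 2 lambda(A, l, row) of one of them; this
    takes O(pql) time. The exact products of the l chosen rows with all columns of
    B take O(lqr) = O(pql) time since r <= p, and replacing a row by a row at
    Hamming distance d changes each inner product by at most d, so copying to
    every row of D the products of its closest center gives the bound. Part (2) is
    the same program run with other strides, the columns of B playing the role of
    the rows of A. *)

(* mathcomp's [int_scope] has taken over the key [Z]. *)
Local Delimit Scope Z_scope with Z.

(** Taking a farthest point makes the new center at least as far from the older ones as any point is
    from its closest center, and these distances only decrease later. So the final distance [d] of a
    point to its closest center is a lower bound on all mutual distances in the set formed by that
    point and the l centers. Two of these l + 1 points are served by the same point of an optimal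
    solution, each within lambda of it, whence [d] is at most 2 lambda. The centers may repeat: then
    some distance is 0 and so is [d].

    The machine has absolute jumps, counts every instruction and bounds every written word, so the
    code is written in a small structured language whose specifications carry the time and fail on
    an oversized word. Only the packing inequality passes from the run of the program to the
    combinatorics; lambda never occurs in the reasoning about memory. *)

Notation memory := (Z -> Z).

(** * Structured commands with timed specifications *)

Lemma upd_eq (m : memory) a v : upd m a v a = v.
Proof. by rewrite /upd Z.eqb_refl. Qed.

Lemma upd_neq (m : memory) a v b : b <> a -> upd m a v b = m b.
Proof. by rewrite /upd => /Z.eqb_neq ->. Qed.

(** [While] and [If] run their body when the cell [a] is positive, the negation of the test made by
    [IJle]. *)
Inductive cmd :=
| Blk (s : seq instr)
| Seq (c1 c2 : cmd)
| While (a : Z) (c : cmd)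
| If (a : Z) (c : cmd).

Fixpoint csize (c : cmd) : nat :=
  match c with
  | Blk s => size s
  | Seq c1 c2 => csize c1 + csize c2
  | While _ c => (csize c).+2
  | If _ c => (csize c).+1
  end.

(** Jump targets are absolute, so the code depends on the position [pc] where it will be placed. *)
Fixpoint compile (pc : nat) (c : cmd) : seq instr :=
  match c with
  | Blk s => s
  | Seq c1 c2 => compile pc c1 ++ compile (pc + csize c1) c2
  | While a c => IJle a (pc + (csize c).+2) :: compile pc.+1 c ++ [:: IJmp pc]
  | If a c => IJle a (pc + (csize c).+1) :: compile pc.+1 c
  end.

Lemma size_compile pc c : size (compile pc c) = csize c.
Proof.
elim: c pc => [s|c1 IH1 c2 IH2|a c IH|a c IH] pc //=.
- by rewrite size_cat IH1 IH2.
- by rewrite size_cat IH /= addn1.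
- by rewrite IH.
Qed.

Definition effect (i : instr) (m : memory) : option (Z * Z) :=
  match i with
  | IConst d z => Some (d, z)
  | IAdd d a b => Some (d, (m a + m b)%Z)
  | ISub d a b => Some (d, (m a - m b)%Z)
  | IMul d a b => Some (d, (m a * m b)%Z)
  | IDiv d a b => Some (d, (m a / m b)%Z)
  | ILoad d a => Some (d, m (m a))
  | IStore a s => Some (m a, m s)
  | _ => None
  end.

Section Machine.

Variable W : Z.

Fixpoint blk (s : seq instr) (m : memory) (Q : memory -> Prop) : Prop :=
  if s is i :: s' then
    if effect i m is Some (a, v)
    then (Z.abs v <= W)%Z /\ blk s' (upd m a v) Q else False
  else Q m.

Lemma blk_cons i s m (Q : memory -> Prop) a v :
  effect i m = Some (a, v) -> (Z.abs v <= W)%Z -> blk s (upd m a v) Q ->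
  blk (i :: s) m Q.
Proof. by move=> /= ->. Qed.

(* Placed anywhere in a larger program, [c] runs from [m] in at most [n] steps
   to its own end, in a memory satisfying [Q]. *)
Definition spec (c : cmd) (m : memory) (n : nat) (Q : memory -> Prop) : Prop :=
  forall P pre post, P = pre ++ compile (size pre) c ++ post ->
  exists k m', [/\ k <= n, Q m' &
    forall f, run W P (k + f) (size pre) m = run W P f (size pre + csize c) m'].

Lemma spec_blk s m n (Q : memory -> Prop) :
  size s <= n -> blk s m Q -> spec (Blk s) m n Q.
Proof.
move=> sn H P pre post eP; exists (size s).
suff [m' Qm' E]: exists2 m', Q m' & forall f,
    run W P (size s + f) (size pre) m = run W P f (size pre + size s) m'.
  by exists m'.
elim: s pre m {sn} H eP => [|i s IH] pre m /=; first by exists m; rewrite ?addn0.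
case E: (effect i m) => [[a v]|//] [/Z.leb_le vW H] eP.
have eP' : P = rcons pre i ++ s ++ post by rewrite cat_rcons.
have [m' Qm' E'] := IH (rcons pre i) (upd m a v) H eP'.
exists m' => // f.
have -> : size pre + (size s).+1 = size (rcons pre i) + size s.
  by rewrite size_rcons addSn addnS.
rewrite -E' /= {1}eP nth_cat ltnn subnn /= size_rcons.
by case: i E {eP eP' E'} => //= *;
   match goal with H : Some _ = Some _ |- _ => case: H => -> -> end; rewrite vW.
Qed.

Lemma spec_weaken c m n1 n2 (Q1 Q2 : memory -> Prop) :
  n1 <= n2 -> (forall m', Q1 m' -> Q2 m') -> spec c m n1 Q1 -> spec c m n2 Q2.
Proof.
move=> n12 Q12 H P pre post /H[k [m' [kn Qm' E]]].
by exists k, m'; split; [exact: leq_trans n12|exact: Q12|].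
Qed.

Lemma spec_seq c1 c2 m n1 n2 n (Q1 Q : memory -> Prop) :
  n1 + n2 <= n -> spec c1 m n1 Q1 -> (forall m', Q1 m' -> spec c2 m' n2 Q) ->
  spec (Seq c1 c2) m n Q.
Proof.
move=> n12 H1 H2 P pre post /= eP.
have [|k1 [m1 [kn1 Qm1 E1]]] := H1 P pre (compile (size pre + csize c1) c2 ++ post).
  by rewrite eP -!catA.
have [|k2 [m2 [kn2 Qm2 E2]]] := H2 m1 Qm1 P (pre ++ compile (size pre) c1) post.
  by rewrite eP size_cat size_compile -!catA.
exists (k1 + k2), m2; split=> // [|f]; first lia.
by rewrite -addnA E1; move: (E2 f); rewrite size_cat size_compile addnA.
Qed.

Lemma spec_blk_seq s c m n2 n (Q : memory -> Prop) :
  size s + n2 <= n -> blk s m (fun m' => spec c m' n2 Q) ->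
  spec (Seq (Blk s) c) m n Q.
Proof. by move=> sn H; apply: (spec_seq sn) (spec_blk (leqnn _) H) _. Qed.

Lemma spec_if a c m n (Q : memory -> Prop) :
  ((m a <= 0)%Z -> Q m) -> ((0 < m a)%Z -> spec c m n Q) ->
  spec (If a c) m n.+1 Q.
Proof.
move=> H0 H1 P pre post /= eP.
have step f : run W P f.+1 (size pre) m = if Z.leb (m a) 0
    then run W P f (size pre + (csize c).+1) m else run W P f (size pre).+1 m.
  by rewrite /= {1}eP nth_cat ltnn subnn.
case: (Z.leb_spec (m a) 0) step => [/H0 Qm|/H1 Hc] step.
  by exists 1, m; split=> // f; rewrite add1n step.
have [|k [m' [kn Qm' E]]] := Hc P (rcons pre (IJle a (size pre + (csize c).+1))) post.
  by rewrite cat_rcons size_rcons eP.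
exists k.+1, m'; split=> // f; rewrite addSn step.
by move: (E f); rewrite size_rcons addSnnS.
Qed.

(** The tested cell is the loop counter, decremented by the body, and the invariant is indexed by
    the rounds left. A round costs two steps beyond its body, the test and the jump back; the final
    unit is the failing test. *)
Lemma spec_while a c m N n n' (I : nat -> memory -> Prop) :
  (N * n.+2).+1 <= n' -> m a = Z.of_nat N -> I N m ->
  (forall k m1, k < N -> I k.+1 m1 -> m1 a = Z.of_nat k.+1 ->
     spec c m1 n (fun m2 => m2 a = Z.of_nat k /\ I k m2)) ->
  spec (While a c) m n' (I 0).
Proof.
move=> nn' ma Im H P pre post eP.
have step f m1 : run W P f.+1 (size pre) m1 = if Z.leb (m1 a) 0
    then run W P f (size pre + (csize c).+2) m1 else run W P f (size pre).+1 m1.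
  by rewrite /= {1}eP nth_cat ltnn subnn.
suff: forall j m1, j <= N -> m1 a = Z.of_nat j -> I j m1 ->
    exists k m', [/\ k <= (j * n.+2).+1, I 0 m' & forall f,
      run W P (k + f) (size pre) m1 = run W P f (size pre + (csize c).+2) m'].
  by case/(_ N m (leqnn N) ma Im)=> k [m' [kn Im' E]]; exists k, m'; split=> //; lia.
elim=> [|j IH] m1 jN m1a Im1.
  by exists 1, m1; split=> // f; rewrite step m1a.
have [|k [m2 [kn [m2a Im2] E]]] := H j m1 jN Im1 m1a P
    (rcons pre (IJle a (size pre + (csize c).+2))) (IJmp (size pre) :: post).
  by rewrite cat_rcons size_rcons eP /= -catA.
have [k' [m3 [kn' Im3 E']]] := IH m2 (ltnW jN) m2a Im2.
exists (k.+1 + k'.+1), m3; split=> [|//|f].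
  by rewrite mulSn !addSn -addnS; lia.
rewrite -addnA addSn step m1a /= -E'; move: (E (k'.+1 + f)).
rewrite size_rcons => ->; rewrite addSn /= eP nth_cat.
rewrite ifF; last by apply/negbTE; rewrite -leqNgt; lia.
have -> : (size pre).+1 + csize c - size pre = (csize c).+1 by lia.
by rewrite /= -catA nth_cat size_compile ltnn subnn.
Qed.

(** The extra unit of fuel pays for falling off the end, which counts as a halting step. *)
Lemma run_spec c m n (Q : memory -> Prop) :
  spec c m n Q -> exists m', run W (compile 0 c) n.+1 0 m = Some m' /\ Q m'.
Proof.
move=> H; have [|k [m' [kn Qm' E]]] := H (compile 0 c) [::] [::]; first by rewrite cats0.
exists m'; split=> //; have -> : n.+1 = k + (n - k).+1 by lia.
by rewrite E /= add0n nth_default // size_compile.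
Qed.

End Machine.

(** * Hamming distance, packings and the farthest-point traversal *)

Lemma ham_sum q (a b : point q) : ham a b = \sum_(h < q) (a h != b h).
Proof. by rewrite /ham -sum1_card big_mkcond /=; apply: eq_bigr => h _; rewrite inE; case: eqP. Qed.

Lemma hamC q (a b : point q) : ham a b = ham b a.
Proof. by rewrite !ham_sum; apply: eq_bigr => h _; rewrite eq_sym. Qed.

Lemma ham_le q (a b : point q) : ham a b <= q.
Proof. by rewrite -[leqRHS]card_ord max_card. Qed.

Lemma ham_triangle q (a b c : point q) : ham a c <= ham a b + ham b c.
Proof.
rewrite !ham_sum -big_split /=; apply: leq_sum => h _.
by case: (a h) (b h) (c h) => [] [] [].
Qed.

(** Common form of [lambda_row] and [lambda_col], both convertible to it when [x] is [rowpt A] or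
    [colpt B]. *)
Definition lambda_pts n q (x : 'I_n -> point q) l : nat :=
  \big[minn/q]_(T : {ffun 'I_l -> point q})
     \max_(i < n) \big[minn/q]_(t < l) ham (x i) (T t).

(* By pigeonhole, two of the l + 1 points share a nearest center. *)
Lemma packing_lambda n q l (x : 'I_n -> point q) (s : seq 'I_n) d :
  0 < l -> size s = l.+1 -> pairwise (fun i j => d <= ham (x i) (x j)) s ->
  d <= 2 * lambda_pts x l.
Proof.
move=> l0 ss ps.
have far (a b : 'I_l.+1) : a < b ->
    d <= ham (x (tnth (Tuple (introT eqP ss)) a)) (x (tnth (Tuple (introT eqP ss)) b)).
  have y : 'I_n := tnth (Tuple (introT eqP ss)) a; rewrite !(tnth_nth y) /=.
  by have /(pairwiseP y) H := ps; move: (H a b); rewrite !inE ss !ltn_ord /=; apply.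
apply: (big_ind (fun z => d <= 2 * z)).
(* The default [q] of the minimum: the first and last points of [s], at different positions since l
   > 0, are at distance at least [d] and at most [q]. *)
- rewrite mul2n -addnn; apply: leq_trans (leq_addr _ _).
  apply: leq_trans (ham_le _ _); apply: (far ord0 ord_max); exact: l0.
- by move=> z1 z2 h1 h2; rewrite /minn; case: ifP.
move=> T _; set rad := \max_(i < n) _.
have near i : exists t, ham (x i) (T t) <= rad.
  have: exists t, ham (x i) (T t) <= \big[minn/q]_(t < l) ham (x i) (T t).
    apply: (big_ind (fun z => exists t, ham (x i) (T t) <= z)).
    - by exists (Ordinal l0); exact: ham_le.
    - by move=> z1 z2 h1 h2; rewrite /minn; case: ifP.
    - by move=> t _; exists t.
  case=> t ht; exists t; apply: leq_trans ht _.
  exact: (bigmax_sup i).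
pose f a := xchoose (near (tnth (Tuple (introT eqP ss)) a)).
have : ~~ injectiveb f.
  apply/negP => /injectiveP/leq_card; rewrite !card_ord; lia.
case/injectivePn => a [b]; wlog ab : a b / a < b.
  move=> H ne fab; case: (ltngtP a b) => [lt|lt|/val_inj /eqP eq].
  - exact: (H a b).
  - by apply: (H b a) => //; rewrite eq_sym.
  - by rewrite eq in ne.
move=> _ fab; apply: leq_trans (far a b ab) _.
have ha := xchooseP (near (tnth (Tuple (introT eqP ss)) a)).
have hb := xchooseP (near (tnth (Tuple (introT eqP ss)) b)).
rewrite -/(f _) in ha; rewrite -/(f _) -fab hamC in hb.
by rewrite mul2n -addnn; apply: leq_trans (ham_triangle _ (T (f a)) _) (leq_add ha hb).
Qed.

Lemma inner_prod_dist q (x x' y : nat -> bool) :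
  \sum_(0 <= h < q) (x h && y h) <=
  \sum_(0 <= h < q) (x' h && y h) + \sum_(0 <= h < q) (x h != x' h).
Proof.
rewrite -big_split /=; apply: leq_sum => h _.
by case: (x h) (x' h) (y h) => [] [] [].
Qed.

(* Farthest-point traversal: [cs] are the centers visited so far, [ds i] is the
   distance of point [i] to the closest of them, attained at [nr i] (initially
   [ds i = q.+1] exceeds all distances). The last field is what makes [ds i] a
   lower bound on the packing radius of [i :: cs]. *)
Record greedy n q (dist : nat -> nat -> nat) (cs : seq nat) (ds nr : nat -> nat) : Prop :=
  Greedy {
    greedy_lt : all (fun c => c < n) cs;
    greedy_ds : forall i, i < n -> ds i = q.+1 \/ nr i \in cs /\ ds i = dist i (nr i);
    greedy_min : forall i, i < n -> all (fun c => ds i <= dist i c) cs;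
    greedy_pack : forall i, i < n -> pairwise (fun a b => ds i <= dist a b) cs
  }.

Lemma greedy0 n q dist nr : greedy n q dist [::] (fun=> q.+1) nr.
Proof. by split=> // i _; left. Qed.

(** The packing survives because the new value at [i] is at most [ds i], hence at most [ds c], which
    [greedy_min] bounds by the distance from [c] to each older center. Listing the newest center
    first makes symmetry of [dist] unnecessary. *)
Lemma greedy_step n q dist cs ds nr c :
  c < n -> (forall i, i < n -> ds i <= ds c) -> greedy n q dist cs ds nr ->
  greedy n q dist (c :: cs) (fun i => if dist i c < ds i then dist i c else ds i)
    (fun i => if dist i c < ds i then c else nr i).
Proof.
move=> cn cmax [Hlt Hds Hmin Hpack]; split=> [|i ip|i ip|i ip].
- by rewrite /= cn.
- case: ifP => _; first by right; rewrite mem_head.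
  by case: (Hds i ip) => [|[h1 h2]]; [left|right; rewrite inE h1 orbT].
- apply/andP; split; first by case: ifP => //; lia.
  by apply: sub_all (Hmin i ip) => a; case: ifP; lia.
- apply/andP; split.
    by apply: sub_all (Hmin c cn) => a; move: (cmax i ip); case: ifP; lia.
  by apply: sub_pairwise (Hpack i ip) => a b; case: ifP; lia.
Qed.

(* Non-negative cells hold input and output, so everything else is at negative
   addresses: constants during the run in [-20, -1], temporaries in [-39, -21],
   and for point [i] its distance to the closest center at [-40 - 2 i] and that
   center at [-41 - 2 i]. Coordinate [h] of point [i] is at
   [rBX + i rSI + h rSH], that of vector [j] at [rBY + j rTJ + h rTH], and their
   inner product goes to [rBD + i rDI + j rDJ]; parts (1) and (2) differ only in
   these strides. *)
Notation rONE := (-1)%Z.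
Notation rN := (-2)%Z.
Notation rQ := (-3)%Z.
Notation rR := (-4)%Z.
Notation rL := (-5)%Z.
Notation rBX := (-6)%Z.
Notation rSI := (-7)%Z.
Notation rSH := (-8)%Z.
Notation rBY := (-9)%Z.
Notation rTJ := (-10)%Z.
Notation rTH := (-11)%Z.
Notation rBD := (-12)%Z.
Notation rDI := (-13)%Z.
Notation rDJ := (-14)%Z.
Notation rZERO := (-15)%Z.

Notation rI := (-21)%Z.
Notation rPX := (-22)%Z.
Notation rPY := (-23)%Z.
Notation rPD := (-24)%Z.
Notation rCUR := (-25)%Z.
Notation rNXT := (-26)%Z.
Notation rBEST := (-27)%Z.
Notation rT := (-28)%Z.
Notation rJ := (-29)%Z.

Notation rH := (-30)%Z.
Notation rS := (-31)%Z.
Notation r1 := (-32)%Z.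
Notation r2 := (-33)%Z.
Notation r3 := (-34)%Z.
Notation r4 := (-35)%Z.
Notation r5 := (-36)%Z.
Notation r6 := (-37)%Z.
Notation r7 := (-38)%Z.
Notation r8 := (-39)%Z.

(** * Frame conditions and symbolic execution *)

Definition same (S : Z -> Prop) (m m' : memory) := forall a, S a -> m' a = m a.

Definition nonscratch (a : Z) := ~ (-39 <= a <= -30)%Z.

Lemma some_pair (a a' v v' : Z) : a = a' -> v = v' -> Some (a, v) = Some (a', v').
Proof. by move=> -> ->. Qed.

Ltac side := cbv beta delta [nonscratch]; first [discriminate | lia].

(** Resolves one memory read; [lia] separates the addresses. Known cell values are used only when
    the memory is a variable, so the proofs below often replace an updated memory by a fresh
    variable with a frame condition, which also keeps terms small. *)
Ltac rd1 := match goal with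
 | |- context[upd ?m ?a ?v ?a] => rewrite (upd_eq m a v)
 | |- context[upd ?m ?a ?v ?b] => rewrite (@upd_neq m a v b); [|solve [side]]
 | H : ?m ?a = _ |- context[?m ?a] => is_var m; rewrite H
 | F : same _ ?m ?m1 |- context[?m1 ?b] => rewrite (F b); [|solve [side]]
 end.

Ltac rd := repeat rd1.

(* Executes one instruction; [v] is the value that it writes. *)
Ltac op v := apply: (@blk_cons _ _ _ _ _ _ v);
  [cbn [effect]; rd; apply: some_pair; [reflexivity | first [reflexivity | lia]]
  |try lia|].

Definition inner_val (d : bool) (x y : bool) : bool := if d then x != y else x && y.

(** On bits the Hamming term is the squared difference. The difference is computed for both values
    of [d], so that both loops have the same length; [sb] names the register holding the stride of
    the second vector. *)
Definition inner (d : bool) (sb : Z) : cmd :=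
  Seq (Blk [:: IConst rS 0; IAdd rH rQ rZERO])
  (While rH (Blk [:: ISub rH rH rONE;
     IMul r1 rH rSH; IAdd r1 rPX r1; ILoad r2 r1;
     IMul r1 rH sb; IAdd r1 rPY r1; ILoad r3 r1;
     ISub r4 r2 r3; if d then IMul r2 r4 r4 else IMul r2 r2 r3;
     IAdd rS rS r2])).

Lemma sum_bits_le a b (f : nat -> bool) : \sum_(a <= h < b) f h <= b - a.
Proof.
rewrite -[leqRHS]muln1 -sum_nat_const_nat; apply: leq_sum => h _; exact: leq_b1.
Qed.

Section InnerLoop.

Variable W : Z.

Lemma inner_ok d sb m q px py sx sy (x y : nat -> bool) :
  (-20 <= sb <= -1)%Z -> m rQ = Z.of_nat q -> m rONE = 1%Z -> m rZERO = 0%Z ->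
  m rSH = sx -> m sb = sy -> m rPX = px -> m rPY = py ->
  (0 <= sx)%Z -> (0 <= sy)%Z -> (0 <= px)%Z -> (0 <= py)%Z ->
  (Z.of_nat q < W)%Z ->
  (forall h, h < q -> (4 <= px + Z.of_nat h * sx <= W)%Z /\
     m (px + Z.of_nat h * sx)%Z = Z.of_nat (x h)) ->
  (forall h, h < q -> (4 <= py + Z.of_nat h * sy <= W)%Z /\
     m (py + Z.of_nat h * sy)%Z = Z.of_nat (y h)) ->
  spec W (inner d sb) m (12 * q + 3) (fun m' => same nonscratch m m' /\
    m' rS = Z.of_nat (\sum_(0 <= h < q) inner_val d (x h) (y h))).
Proof.
move=> sbr mQ mONE mZERO mSH msb mPX mPY sx0 sy0 px0 py0 qW hx hy.
pose I k m' := same nonscratch m m' /\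
  m' rS = Z.of_nat (\sum_(k <= h < q) inner_val d (x h) (y h)).
apply: (@spec_blk_seq _ _ _ _ (12 * q + 1)); first (simpl; lia).
op 0%Z.
op (Z.of_nat q).
apply: (@spec_while _ _ _ _ q 10 _ I); [lia|by rd| | ].
  split; last by rd; rewrite big_geq.
  by move=> a Ha; rewrite !upd_neq //; move: Ha; rewrite /nonscratch; lia.
move=> k m1 kq [F m1S] m1H; apply: spec_blk; first by case: (d).
have [ax mx] := hx k kq; have [ay my] := hy k kq.
have kx : (0 <= Z.of_nat k * sx)%Z by apply: Z.mul_nonneg_nonneg; lia.
have ky : (0 <= Z.of_nat k * sy)%Z by apply: Z.mul_nonneg_nonneg; lia.
have bx := leq_b1 (x k); have bY := leq_b1 (y k).
op (Z.of_nat k).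
op (Z.of_nat k * sx)%Z.
op (px + Z.of_nat k * sx)%Z.
op (Z.of_nat (x k)).
op (Z.of_nat k * sy)%Z.
op (py + Z.of_nat k * sy)%Z.
op (Z.of_nat (y k)).
op (Z.of_nat (x k) - Z.of_nat (y k))%Z.
have bs := sum_bits_le k q (fun h => inner_val d (x h) (y h)).
have es : \sum_(k <= h < q) inner_val d (x h) (y h) =
  inner_val d (x k) (y k) + \sum_(k.+1 <= h < q) inner_val d (x h) (y h).
  exact: big_ltn.
apply: (@blk_cons _ _ _ _ _ r2 (Z.of_nat (inner_val d (x k) (y k)))).
- case: (d) (x k) (y k) => [] [] []; cbn [effect]; rd; exact: some_pair.
- by case: (inner_val _ _ _); lia.
op (Z.of_nat (\sum_(k <= h < q) inner_val d (x h) (y h))).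
split; first by rd.
split; last by rd.
move=> a Ha; rewrite !upd_neq; first exact: F.
all: by move: Ha; rewrite /nonscratch; lia.
Qed.

End InnerLoop.

(** * The program *)

Definition fill_row : cmd :=
  Seq (Blk [:: IMul r1 rCUR rSI; IAdd rPX rBX r1; IMul r1 rCUR rDI; IAdd rPD rBD r1;
               IAdd rJ rR rZERO])
  (While rJ (Seq (Blk [:: ISub rJ rJ rONE; IMul r1 rJ rTJ; IAdd rPY rBY r1])
            (Seq (inner false rTH)
            (Blk [:: IMul r1 rJ rDJ; IAdd r1 rPD r1; IStore r1 rS])))).

(** [rBEST] starts at -1, below every distance, so the first point visited always sets [rNXT]. *)
Definition update : cmd :=
  Seq (Blk [:: IConst rBEST (-1); IMul r1 rCUR rSI; IAdd rPY rBX r1; IAdd rI rN rZERO])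
  (While rI (Seq (Blk [:: ISub rI rI rONE; IMul r1 rI rSI; IAdd rPX rBX r1])
            (Seq (inner true rSH)
            (Seq (Blk [:: IAdd r5 rI rI; IConst r6 (-40); ISub r6 r6 r5; ILoad r7 r6;
                          ISub r8 r7 rS])
            (Seq (If r8 (Blk [:: IStore r6 rS; ISub r5 r6 rONE; IStore r5 rCUR;
                                 IAdd r7 rS rZERO]))
            (Seq (Blk [:: ISub r8 r7 rBEST])
            (If r8 (Blk [:: IAdd rBEST r7 rZERO; IAdd rNXT rI rZERO])))))))).

(* Working in place is safe: a center can only be overwritten with the products
   of a center at distance 0 from it. *)
Definition copy_rows : cmd :=
  Seq (Blk [:: IAdd rI rN rZERO])
  (While rI (Seq (Blk [:: ISub rI rI rONE; IMul r1 rI rDI; IAdd rPD rBD r1;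
                          IAdd r5 rI rI; IConst r6 (-41); ISub r6 r6 r5; ILoad r7 r6;
                          IMul r1 r7 rDI; IAdd rPX rBD r1; IAdd rJ rR rZERO])
            (While rJ (Blk [:: ISub rJ rJ rONE; IMul r1 rJ rDJ; IAdd r2 rPX r1; ILoad r2 r2;
                               IAdd r3 rPD r1; IStore r3 r2])))).

(** Point 0 is a legitimate first center: all initial distances are equal, so every point is a
    farthest one. *)
Definition init_dists : cmd :=
  Seq (Blk [:: IConst rCUR 0; IAdd rI rN rZERO; IAdd rT rL rZERO])
  (While rI (Blk [:: ISub rI rI rONE; IAdd r5 rI rI; IConst r6 (-40); ISub r6 r6 r5;
                     IAdd r7 rQ rONE; IStore r6 r7; ISub r6 r6 rONE; IStore r6 rZERO])).

Definition main : cmd :=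
  Seq init_dists
  (Seq (While rT (Seq (Blk [:: ISub rT rT rONE]) (Seq fill_row (Seq update
                 (Blk [:: IAdd rCUR rNXT rZERO])))))
  copy_rows).

(** * Correctness and running time for arbitrary strides *)

Section Program.

Variables (W : Z) (n q w l : nat) (X Y : nat -> nat -> bool) (m0 : memory).
Variables (bx si sh bY tj th bd di dj : Z).
Hypothesis n_gt0 : 0 < n.
(** Addresses are words too: the table of distances and centers reaches down to -39 - 2n, and its
    offsets are the constants -40 and -41. The bound q + 2 covers a distance, at most q + 1, minus
    [rBEST], at least -1. *)
Hypotheses (qW : (Z.of_nat q + 2 <= W)%Z) (nW : (2 * Z.of_nat n + 41 <= W)%Z)
  (wW : (Z.of_nat w <= W)%Z) (lW : (Z.of_nat l <= W)%Z).
Hypotheses (m0ONE : m0 rONE = 1%Z) (m0N : m0 rN = Z.of_nat n) (m0Q : m0 rQ = Z.of_nat q)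
  (m0R : m0 rR = Z.of_nat w) (m0L : m0 rL = Z.of_nat l)
  (m0BX : m0 rBX = bx) (m0SI : m0 rSI = si) (m0SH : m0 rSH = sh)
  (m0BY : m0 rBY = bY) (m0TJ : m0 rTJ = tj) (m0TH : m0 rTH = th)
  (m0BD : m0 rBD = bd) (m0DI : m0 rDI = di) (m0DJ : m0 rDJ = dj) (m0ZERO : m0 rZERO = 0%Z).
Hypotheses (bx0 : (0 <= bx)%Z) (si0 : (0 <= si)%Z) (sh0 : (0 <= sh)%Z)
  (bY0 : (0 <= bY)%Z) (tj0 : (0 <= tj)%Z) (th0 : (0 <= th)%Z)
  (bd4 : (4 <= bd)%Z) (di0 : (0 <= di)%Z) (dj0 : (0 <= dj)%Z).
Hypothesis hX : forall i h, i < n -> h < q ->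
  (4 <= bx + Z.of_nat i * si + Z.of_nat h * sh < bd)%Z /\
  m0 (bx + Z.of_nat i * si + Z.of_nat h * sh)%Z = Z.of_nat (X i h).
Hypothesis hY : forall j h, j < w -> h < q ->
  (4 <= bY + Z.of_nat j * tj + Z.of_nat h * th < bd)%Z /\
  m0 (bY + Z.of_nat j * tj + Z.of_nat h * th)%Z = Z.of_nat (Y j h).
Hypothesis bdW : (bd + Z.of_nat n * di + Z.of_nat w * dj <= W)%Z.
Hypothesis dinj : forall i j i' j', i < n -> j < w -> i' < n -> j' < w ->
  (bd + Z.of_nat i * di + Z.of_nat j * dj)%Z =
  (bd + Z.of_nat i' * di + Z.of_nat j' * dj)%Z -> i = i' /\ j = j'.

(** Parameter registers and input matrices, which the program only reads. *)
Definition fixed (a : Z) := (-20 <= a <= -1 \/ 4 <= a < bd)%Z.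

Notation aD i j := (bd + Z.of_nat i * di + Z.of_nat j * dj)%Z.

Definition row_prod (c j : nat) : nat := \sum_(0 <= h < q) inner_val false (X c h) (Y j h).
Definition row_dist (i c : nat) : nat := \sum_(0 <= h < q) inner_val true (X i h) (X c h).

Definition offD (a : Z) := forall i j, i < n -> j < w -> a <> aD i j.

Section NonemptyPoints.

Hypothesis q_gt0 : 0 < q.

(** As q > 0, this is the address of coordinate 0 of a point, so it lies in the input. *)
Lemma aXrow i : i < n -> (0 <= Z.of_nat i * si /\ bx + Z.of_nat i * si <= W)%Z.
Proof.
move=> ip; have [h _] := hX ip q_gt0.
have := Z.mul_nonneg_nonneg (Z.of_nat i) si.
have := Z.mul_nonneg_nonneg (Z.of_nat n) di.
have := Z.mul_nonneg_nonneg (Z.of_nat w) dj; lia.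
Qed.

Lemma aYrow j : j < w -> (0 <= Z.of_nat j * tj /\ bY + Z.of_nat j * tj <= W)%Z.
Proof.
move=> jp; have [h _] := hY jp q_gt0.
have := Z.mul_nonneg_nonneg (Z.of_nat j) tj.
have := Z.mul_nonneg_nonneg (Z.of_nat n) di.
have := Z.mul_nonneg_nonneg (Z.of_nat w) dj; lia.
Qed.

Lemma bdleW : (bd <= W)%Z.
Proof.
have := Z.mul_nonneg_nonneg (Z.of_nat n) di.
have := Z.mul_nonneg_nonneg (Z.of_nat w) dj; lia.
Qed.

Lemma aDrow i : i < n -> (0 <= Z.of_nat i * di /\ bd + Z.of_nat i * di <= W)%Z.
Proof.
move=> ip.
have := Z.mul_nonneg_nonneg (Z.of_nat i) di.
have := Z.mul_le_mono_nonneg_r (Z.of_nat i) (Z.of_nat n) di.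
have := Z.mul_nonneg_nonneg (Z.of_nat w) dj; lia.
Qed.

Lemma aDcol i j : i < n -> j < w -> (0 <= Z.of_nat j * dj /\ aD i j <= W)%Z.
Proof.
move=> ip jp.
have := Z.mul_nonneg_nonneg (Z.of_nat j) dj.
have := Z.mul_le_mono_nonneg_r (Z.of_nat i) (Z.of_nat n) di.
have := Z.mul_le_mono_nonneg_r (Z.of_nat j) (Z.of_nat w) dj; lia.
Qed.

(** Excludes the temporaries of [fill_row]; [upreg] and [copyreg] are the analogous frames of
    [update] and [copy_rows]. *)
Definition prodreg (a : Z) := ~ (-39 <= a <= -29 \/ -24 <= a <= -22)%Z.

Lemma fill_row_ok m c : same fixed m0 m -> c < n -> m rCUR = Z.of_nat c ->
  spec W fill_row m (w * (12 * q + 11) + 6) (fun m' =>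
    same (fun a => prodreg a /\ forall j, j < w -> a <> aD c j) m m' /\
    forall j, j < w -> m' (aD c j) = Z.of_nat (row_prod c j)).
Proof.
move=> F0 cn mCUR; have [cx0 cxW] := aXrow cn; have [cd0 cdW] := aDrow cn.
have bW := bdleW.
have F0' : same (fun a => (-20 <= a <= -1)%Z) m0 m by move=> a Ha; apply: F0; left.
pose I k m' := [/\ same (fun a => prodreg a /\ forall j, j < w -> a <> aD c j) m m',
  m' rPX = (bx + Z.of_nat c * si)%Z, m' rPD = (bd + Z.of_nat c * di)%Z &
  forall j, k <= j -> j < w -> m' (aD c j) = Z.of_nat (row_prod c j)].
apply: (@spec_weaken _ _ _ _ _ (I 0)); [exact: leqnn| |].
  by move=> m' [? _ _ H]; split=> // j; apply: H.
apply: (@spec_blk_seq _ _ _ _ (w * (12 * q + 11) + 1)); first (simpl; lia).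
op (Z.of_nat c * si)%Z.
op (bx + Z.of_nat c * si)%Z.
op (Z.of_nat c * di)%Z.
op (bd + Z.of_nat c * di)%Z.
op (Z.of_nat w).
apply: (@spec_while _ _ _ _ w (12 * q + 9) _ I); [lia|by rd| | ].
  split; [|by rd|by rd|by move=> j; lia].
  by move=> a [Ha _]; rewrite !upd_neq //; move: Ha; rewrite /prodreg; lia.
move=> k m1 kw [F1 m1PX m1PD m1D] m1J.
have [kj0 kjW] := aYrow kw; have [kd0 kdW] := aDcol cn kw.
have F2 : same fixed m0 m1.
  move=> a Ha; rewrite F1 ?F0 //; split=> [|j jw]; first by move: Ha; rewrite /prodreg /fixed; lia.
  by have [] := aDcol cn jw; move: Ha; rewrite /fixed; lia.
have F2' : same (fun a => (-20 <= a <= -1)%Z) m0 m1 by move=> a Ha; apply: F2; left.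
have F2'' : same (fun a => (4 <= a < bd)%Z) m0 m1 by move=> a Ha; apply: F2; right.
apply: (@spec_blk_seq _ _ _ _ (12 * q + 6)); first (simpl; lia).
op (Z.of_nat k).
op (Z.of_nat k * tj)%Z.
op (bY + Z.of_nat k * tj)%Z.
set m2 := upd _ _ _.
have F3 : same (fun a => prodreg a) m1 m2.
  by move=> a; rewrite /prodreg => Ha; rewrite /m2; rd.
have m2PX : m2 rPX = (bx + Z.of_nat c * si)%Z by rewrite /m2; rd.
have m2PY : m2 rPY = (bY + Z.of_nat k * tj)%Z by rewrite /m2; rd.
have m2PD : m2 rPD = (bd + Z.of_nat c * di)%Z by rewrite /m2; rd.
have m2J : m2 rJ = Z.of_nat k by rewrite /m2; rd.
move: m2 F3 m2PX m2PY m2PD m2J => m2 F3 m2PX m2PY m2PD m2J; rewrite /prodreg in F3.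
apply: (@spec_seq _ _ _ _ (12 * q + 3) 3); first lia.
  apply: (@inner_ok W false rTH m2 q _ _ sh th (X c) (Y k) _ _ _ _ _ _ m2PX m2PY);
    try (by rd); try lia.
  - move=> h hq; have [ha Xa] := hX cn hq; split; [lia|by rd].
  - move=> h hq; have [ha Ya] := hY kw hq; split; [lia|by rd].
move=> m3 [F4 m3S].
have prq : row_prod c k <= q by rewrite /row_prod (leq_trans (sum_bits_le _ _ _)) ?subn0.
rewrite -/(row_prod c k) in m3S.
apply: spec_blk => //.
op (Z.of_nat k * dj)%Z.
op (aD c k)%Z.
apply: (@blk_cons _ _ _ _ _ (aD c k) (Z.of_nat (row_prod c k))); [by cbn [effect]; rd|lia|].
split; first by rd.
split; [|by rd|by rd|].
- move=> a [Ha HD]; rewrite (upd_neq _ _ (HD k kw)); rewrite /prodreg in Ha; rd.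
  apply: F1; split=> //; exact: Ha.
- move=> j kj jw; have [jd0 jdW] := aDcol cn jw.
  case: (eqVneq j k) => [->|/eqP jk]; first by rd.
  rewrite upd_neq; last by case/(dinj cn jw cn kw).
  rewrite !upd_neq; [|lia|lia].
  rd; apply: m1D => //; lia.
Qed.

Notation aDs i := (-40 - 2 * Z.of_nat i)%Z.
Notation aNr i := (-41 - 2 * Z.of_nat i)%Z.

Definition upreg (a : Z) :=
  ~ (-39 - 2 * Z.of_nat n <= a <= -30 \/ -27 <= a <= -26 \/ -23 <= a <= -21)%Z.

Definition upds c ds i := if row_dist i c < ds i then row_dist i c else ds i.
Definition upnr c ds nr i := if row_dist i c < ds i then c else nr i.

Lemma update_ok m c (ds nr : nat -> nat) : same fixed m0 m -> c < n ->
  m rCUR = Z.of_nat c ->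
  (forall i, i < n -> [/\ m (aDs i) = Z.of_nat (ds i), m (aNr i) = Z.of_nat (nr i) &
     ds i <= q.+1]) ->
  spec W update m (n * (12 * q + 24) + 5) (fun m' =>
    [/\ same upreg m m',
      forall i, i < n -> m' (aDs i) = Z.of_nat (upds c ds i) /\
                         m' (aNr i) = Z.of_nat (upnr c ds nr i) &
      exists x, [/\ x < n, m' rNXT = Z.of_nat x &
        forall i, i < n -> upds c ds i <= upds c ds x]]).
Proof.
move=> F0 cn mCUR marr; have [cx0 cxW] := aXrow cn; have bW := bdleW.
have F0' : same (fun a => (-20 <= a <= -1)%Z) m0 m by move=> a Ha; apply: F0; left.
(* Indices decrease, so the points visited are those from [k] on. Either none has been visited and
   [rBEST] is still -1, or [rBEST] is the largest updated distance among them, attained at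
   [rNXT]. *)
pose I k m' := [/\ same upreg m m', m' rPY = (bx + Z.of_nat c * si)%Z,
  forall i, i < n ->
    m' (aDs i) = Z.of_nat (if k <= i then upds c ds i else ds i) /\
    m' (aNr i) = Z.of_nat (if k <= i then upnr c ds nr i else nr i) &
  k = n /\ m' rBEST = (-1)%Z \/ exists x, [/\ k <= x < n, m' rNXT = Z.of_nat x,
     m' rBEST = Z.of_nat (upds c ds x) &
     forall i, k <= i < n -> upds c ds i <= upds c ds x]].
apply: (@spec_weaken _ _ _ _ _ (I 0)); [exact: leqnn| |].
  move=> m' [? _ H [[n0] | [x [xn mN mB mx]]]]; first lia.
  by split=> //; exists x.
apply: (@spec_blk_seq _ _ _ _ (n * (12 * q + 24) + 1)); first (simpl; lia).
op (-1)%Z.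
op (Z.of_nat c * si)%Z.
op (bx + Z.of_nat c * si)%Z.
op (Z.of_nat n).
apply: (@spec_while _ _ _ _ n (12 * q + 22) _ I); [lia|by rd| | ].
  split; [|by rd| |by left; rd].
  - by move=> a Ha; rewrite !upd_neq //; move: Ha; rewrite /upreg; lia.
  - move=> i ip; have [d1 d2 _] := marr i ip; have -> : (n <= i) = false by lia.
    by split; rd.
move=> k m1 kn [F1 m1PY m1arr m1best] m1I.
have [kx0 kxW] := aXrow kn.
have F2 : same fixed m0 m1.
  by move=> a Ha; rewrite F1 ?F0 //; move: Ha; rewrite /upreg /fixed; lia.
have F2' : same (fun a => (-20 <= a <= -1)%Z) m0 m1 by move=> a Ha; apply: F2; left.
have F2'' : same (fun a => (4 <= a < bd)%Z) m0 m1 by move=> a Ha; apply: F2; right.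
have m1CUR : m1 rCUR = Z.of_nat c by rewrite F1 // /upreg; lia.
apply: (@spec_blk_seq _ _ _ _ (12 * q + 19)); first (simpl; lia).
op (Z.of_nat k).
op (Z.of_nat k * si)%Z.
op (bx + Z.of_nat k * si)%Z.
set m2 := upd _ _ _.
have F3 : same (fun a => a <> r1 /\ a <> rPX /\ a <> rI) m1 m2.
  by move=> a Ha; rewrite /m2; rd.
have m2PX : m2 rPX = (bx + Z.of_nat k * si)%Z by rewrite /m2; rd.
have m2I : m2 rI = Z.of_nat k by rewrite /m2; rd.
move: m2 F3 m2PX m2I => m2 F3 m2PX m2I.
have m2PY : m2 rPY = (bx + Z.of_nat c * si)%Z by rd.
apply: (@spec_seq _ _ _ _ (12 * q + 3) 16); first lia.
  apply: (@inner_ok W true rSH m2 q _ _ sh sh (X k) (X c) _ _ _ _ _ _ m2PX m2PY);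
    try (by rd); try lia.
  - move=> h hq; have [ha Xa] := hX kn hq; split; [lia|by rd].
  - move=> h hq; have [ha Ya] := hX cn hq; split; [lia|by rd].
move=> m3 [F4 m3S]; rewrite /nonscratch in F4.
have hmq : row_dist k c <= q by rewrite /row_dist (leq_trans (sum_bits_le _ _ _)) ?subn0.
rewrite -/(row_dist k c) in m3S.
have [m1d m1n] := m1arr k kn; rewrite ltnn in m1d m1n.
have [_ _ dsq] := marr k kn.
apply: (@spec_blk_seq _ _ _ _ 11) => //.
op (Z.of_nat k + Z.of_nat k)%Z.
op (-40)%Z.
op (aDs k).
op (Z.of_nat (ds k)).
op (Z.of_nat (ds k) - Z.of_nat (row_dist k c))%Z.
set m4 := upd _ _ _.
have F5 : same (fun a => ~(-39 <= a <= -36)%Z) m3 m4.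
  by move=> a Ha; rewrite /m4; rd.
have m46 : m4 r6 = (aDs k)%Z by rewrite /m4; rd.
have m47 : m4 r7 = Z.of_nat (ds k) by rewrite /m4; rd.
have m48 : m4 r8 = (Z.of_nat (ds k) - Z.of_nat (row_dist k c))%Z by rewrite /m4; rd.
move: m4 F5 m46 m47 m48 => m4 F5 m46 m47 m48.
have m4d : m4 (aDs k) = Z.of_nat (ds k) by rd.
have m4n : m4 (aNr k) = Z.of_nat (nr k) by rd.
have m4I : m4 rI = Z.of_nat k by rd.
have m4CUR : m4 rCUR = Z.of_nat c by rd.
have m4S : m4 rS = Z.of_nat (row_dist k c) by rd.
have m4ONE : m4 rONE = 1%Z by rd.
have m4ZERO : m4 rZERO = 0%Z by rd.
have F6 : same (fun a => ~(-39 <= a <= -30)%Z /\ a <> rPX /\ a <> rI) m1 m4.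
  by move=> a Ha; rd.
have uq : upds c ds k <= q.+1 by rewrite /upds; case: ifP; lia.
apply: (@spec_seq _ _ _ _ 5 6 _ (fun m5 => [/\
    same (fun a => ~(-39 <= a <= -36)%Z /\ a <> aDs k /\ a <> aNr k) m4 m5,
    m5 r7 = Z.of_nat (upds c ds k), m5 (aDs k) = Z.of_nat (upds c ds k) &
    m5 (aNr k) = Z.of_nat (upnr c ds nr k)])) => //.
  rewrite /upds /upnr; apply: spec_if; rewrite m48 => cmp.
    by have -> : (row_dist k c < ds k) = false by lia.
  have -> : (row_dist k c < ds k) = true by lia.
  apply: spec_blk => //.
  op (Z.of_nat (row_dist k c)).
  op (aNr k).
  op (Z.of_nat c).
  op (Z.of_nat (row_dist k c)).
  split; [|by rd|by rd|by rd].
  by move=> a Ha; rewrite !upd_neq //; lia.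
move=> m5 [F7 m57 m5d m5n].
have m5arr i : i < n -> m5 (aDs i) = Z.of_nat (if k <= i then upds c ds i else ds i) /\
    m5 (aNr i) = Z.of_nat (if k <= i then upnr c ds nr i else nr i).
  move=> ip; case: (ltngtP k i) => [ki|ik|<- //].
  - have [d1 d2] := m1arr i ip; rewrite ki in d1 d2; by rd.
  - have [d1 d2] := m1arr i ip; move: d1 d2; have -> : (k < i) = false by lia.
    by move=> d1 d2; split; rd.
have m5PY : m5 rPY = (bx + Z.of_nat c * si)%Z by rd.
have m5I : m5 rI = Z.of_nat k by rd.
have F8 : same upreg m m5.
  by move=> a; rewrite /upreg => Ha; rd; apply: F1.
have m5ZERO : m5 rZERO = 0%Z by rd.
have m5B : m5 rBEST = m1 rBEST by rd.
have m5N : m5 rNXT = m1 rNXT by rd.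
have bB : (-1 <= m1 rBEST <= Z.of_nat q + 1)%Z.
  case: m1best => [[_ ->]|[x [/andP[_ xn] _ -> _]]]; first lia.
  by have [_ _] := marr x xn; rewrite /upds; case: ifP; lia.
apply: (@spec_blk_seq _ _ _ _ 3) => //.
op (Z.of_nat (upds c ds k) - m1 rBEST)%Z.
set m6 := upd _ _ _.
have m68 : m6 r8 = (Z.of_nat (upds c ds k) - m1 rBEST)%Z by rewrite /m6; rd.
have F9 : same (fun a => a <> r8) m5 m6.
  by move=> a Ha; rewrite /m6; rd.
move: m6 F9 m68 => m6 F9 m68.
have F10 : same upreg m m6.
  by move=> a; rewrite /upreg => Ha; rewrite F9; [apply: F8|lia].
have m6PY : m6 rPY = (bx + Z.of_nat c * si)%Z by rd.
have m6I : m6 rI = Z.of_nat k by rd.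
have m6arr i : i < n -> m6 (aDs i) = Z.of_nat (if k <= i then upds c ds i else ds i) /\
    m6 (aNr i) = Z.of_nat (if k <= i then upnr c ds nr i else nr i).
  by move=> ip; have [d1 d2] := m5arr i ip; rd.
apply: spec_if; rewrite m68 => cmp.
  case: m1best => [[_ E]|[x [xn mx Bx Hx]]]; first lia.
  split=> //; split=> //; right; exists x; split=> [|||i ki]; [lia|by rd|by rd|].
  by case: (ltngtP k i) => [ki'|ik|<-]; [apply: Hx|..]; lia.
apply: spec_blk => //.
op (Z.of_nat (upds c ds k)).
op (Z.of_nat k).
split; first by rd.
split; [|by rd| |].
- by move=> a Ha; rewrite !upd_neq ?F10 //; move: Ha; rewrite /upreg; lia.
- by move=> i ip; have [d1 d2] := m6arr i ip; rd.
right; exists k; split=> [|||i ki]; [lia|by rd|by rd|].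
case: (ltngtP k i) => [ki'|ik|<-]; [|lia|lia].
case: m1best => [[E _]|[x [xn mx Bx Hx]]]; first lia.
have := Hx i; lia.
Qed.

Lemma init_dists_ok : spec W init_dists m0 (n * 10 + 4) (fun m' =>
  [/\ same fixed m0 m', m' rCUR = 0%Z, m' rT = Z.of_nat l &
    forall i, i < n -> m' (aDs i) = (Z.of_nat q + 1)%Z /\ m' (aNr i) = 0%Z]).
Proof.
pose I k m' := [/\ same fixed m0 m', m' rCUR = 0%Z, m' rT = Z.of_nat l &
    forall i, k <= i < n -> m' (aDs i) = (Z.of_nat q + 1)%Z /\ m' (aNr i) = 0%Z].
apply: (@spec_weaken _ _ _ _ _ (I 0)); [exact: leqnn|by []|].
apply: (@spec_blk_seq _ _ _ _ (n * 10 + 1)); first (simpl; lia).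
op 0%Z.
op (Z.of_nat n).
op (Z.of_nat l).
apply: (@spec_while _ _ _ _ n 8 _ I); [lia|by rd| | ].
  split; [|by rd|by rd|by move=> i; lia].
  by move=> a Ha; rewrite !upd_neq //; move: Ha; rewrite /fixed; lia.
move=> k m1 kn [F1 m1C m1T m1arr] m1I.
have F1' : same (fun a => (-20 <= a <= -1)%Z) m0 m1 by move=> a Ha; apply: F1; left.
apply: spec_blk => //.
op (Z.of_nat k).
op (Z.of_nat k + Z.of_nat k)%Z.
op (-40)%Z.
op (aDs k).
op (Z.of_nat q + 1)%Z.
op (Z.of_nat q + 1)%Z.
op (aNr k).
op 0%Z.
split; first by rd.
split; [|by rd|by rd|].
- by move=> a Ha; rewrite !upd_neq ?F1 //; move: Ha; rewrite /fixed; lia.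
move=> i; case: (ltngtP k i) => [ki ip|//|<- _]; last by split; rd.
by have [|d1 d2] := m1arr i; [lia|split; rd].
Qed.

Lemma offD_neg a : (a < 4)%Z -> offD a.
Proof. by move=> Ha i j ip jp; have := aDrow ip; have := aDcol ip jp; lia. Qed.

Definition copyreg (a : Z) := ~ (-39 <= a <= -21)%Z /\ offD a.

Lemma copy_rows_ok m (cs : seq nat) nr : same fixed m0 m ->
  (forall i, i < n -> [/\ m (aNr i) = Z.of_nat (nr i), nr i < n & nr i \in cs]) ->
  (forall c j, c \in cs -> j < w -> m (aD c j) = Z.of_nat (row_prod c j)) ->
  (forall c j, c \in cs -> j < w -> c < n /\ row_prod (nr c) j = row_prod c j) ->
  spec W copy_rows m (n * (w * 8 + 13) + 2) (fun m' =>
    forall i j, i < n -> j < w -> m' (aD i j) = Z.of_nat (row_prod (nr i) j)).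
Proof.
move=> F0 mnr mD csD; have bW := bdleW.
(* The second clause keeps every center row valid throughout, so a source row can be read even after
   it has itself been overwritten. *)
pose I k m' := [/\ same copyreg m m',
  forall c j, c \in cs -> j < w -> m' (aD c j) = Z.of_nat (row_prod c j) &
  forall i j, k <= i -> i < n -> j < w -> m' (aD i j) = Z.of_nat (row_prod (nr i) j)].
have F0' : same (fun a => (-20 <= a <= -1)%Z) m0 m by move=> a Ha; apply: F0; left.
apply: (@spec_weaken _ _ _ _ _ (I 0)); [exact: leqnn|by move=> m' [_ _ H] i j; apply: H|].
apply: (@spec_blk_seq _ _ _ _ (n * (w * 8 + 13) + 1)); first (simpl; lia).
op (Z.of_nat n).
apply: (@spec_while _ _ _ _ n (w * 8 + 11) _ I); [lia|by rd| | ].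
  split; last by move=> i j; lia.
  - by move=> a [Ha _]; rewrite !upd_neq //; lia.
  - move=> c j ccs jw; rewrite upd_neq; first exact: mD.
    by have [cn _] := csD c j ccs jw; have := aDrow cn; have := aDcol cn jw; lia.
move=> k m1 kn [F1 m1D m1E] m1I.
have [kd0 kdW] := aDrow kn; have [mk nkn nkcs] := mnr k kn.
have [nd0 ndW] := aDrow nkn.
have F2 : same (fun a => (-20 <= a <= -1)%Z) m0 m1.
  by move=> a Ha; rewrite F1 ?F0' //; split; [lia|apply: offD_neg; lia].
have m1nr : m1 (aNr k) = Z.of_nat (nr k).
  by rewrite F1 //; split; [lia|apply: offD_neg; lia].
apply: (@spec_blk_seq _ _ _ _ (w * 8 + 1)); first (simpl; lia).
op (Z.of_nat k).
op (Z.of_nat k * di)%Z.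
op (bd + Z.of_nat k * di)%Z.
op (Z.of_nat k + Z.of_nat k)%Z.
op (-41)%Z.
op (aNr k).
op (Z.of_nat (nr k)).
op (Z.of_nat (nr k) * di)%Z.
op (bd + Z.of_nat (nr k) * di)%Z.
op (Z.of_nat w).
pose J t m' := [/\ I k.+1 m', m' rI = Z.of_nat k, m' rPD = (bd + Z.of_nat k * di)%Z,
  m' rPX = (bd + Z.of_nat (nr k) * di)%Z &
  forall j, t <= j -> j < w -> m' (aD k j) = Z.of_nat (row_prod (nr k) j)].
apply: (@spec_weaken _ _ _ _ _ (J 0)); [exact: leqnn| |].
  move=> m' [[G1 G2 G3] G4 _ _ G5]; split=> //; split=> // i j.
  by case: (ltngtP k i) => [ki _|//|<- _ _]; [apply: G3|apply: G5].
apply: (@spec_while _ _ _ _ w 6 _ J); [lia|by rd| | ].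
  split; [|by rd|by rd|by rd|by move=> j; lia].
  split.
  - by move=> a [Ha HD]; rewrite !upd_neq ?F1 //; lia.
  - move=> c j ccs jw; have [cn _] := csD c j ccs jw.
    by have := aDrow cn; have := aDcol cn jw; move=> H1 H2; rewrite !upd_neq ?m1D //; lia.
  - move=> i j ki ip jw.
    by have := aDrow ip; have := aDcol ip jw; move=> H1 H2; rewrite !upd_neq ?m1E //; lia.
move=> t m2 tw [[G1 G2 G3] m2I m2PD m2PX G5] m2J.
have [td0 tdW] := aDcol kn tw; have [_ tnW] := aDcol nkn tw.
have F3 : same (fun a => (-20 <= a <= -1)%Z) m0 m2.
  by move=> a Ha; rewrite G1 ?F0' //; split; [lia|apply: offD_neg; lia].
have m2v := G2 _ _ nkcs tw.
have prq : row_prod (nr k) t <= q by rewrite /row_prod (leq_trans (sum_bits_le _ _ _)) ?subn0.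
apply: spec_blk => //.
op (Z.of_nat t).
op (Z.of_nat t * dj)%Z.
op (aD (nr k) t).
op (Z.of_nat (row_prod (nr k) t)).
op (aD k t).
op (Z.of_nat (row_prod (nr k) t)).
split; first by rd.
set m3 := upd _ _ _.
have m3D i j : i < n -> j < w -> m3 (aD i j) =
    if (i == k) && (j == t) then Z.of_nat (row_prod (nr k) t) else m2 (aD i j).
  move=> ip jw; have [? ?] := aDrow ip; have [? ?] := aDcol ip jw.
  rewrite /m3; case: ifP => [/andP[/eqP-> /eqP->]|ne]; first by rd.
  rewrite upd_neq; last by case/(dinj ip jw kn tw) => e1 e2; rewrite e1 e2 !eqxx in ne.
  by rewrite !upd_neq //; lia.
split; [|by rewrite /m3; rd|by rewrite /m3; rd|by rewrite /m3; rd|].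
- split.
  + move=> a [Ha HD]; rewrite /m3 (upd_neq _ _ (HD _ _ kn tw)) !upd_neq ?G1 //; lia.
  (* If the row being overwritten is a center, [E] says that the value written is the one required
     there. *)
  + move=> c j ccs jw; have [cn E] := csD c j ccs jw; rewrite m3D //.
    by case: ifP => [/andP[/eqP e1 /eqP e2]|_]; [rewrite -e1 -e2 E|apply: G2].
  + move=> i j ki ip jw; rewrite m3D // ifF; [exact: G3|lia].
- move=> j le_tj jw; rewrite m3D // eqxx /=.
  by case: eqP => [->//|ne]; apply: G5 => //; lia.
Qed.

Lemma main_ok : 0 < l -> spec W main m0
  (n * 10 + 4 + ((l * (w * (12 * q + 11) + 6 + (n * (12 * q + 24) + 5) + 4)).+1
    + (n * (w * 8 + 13) + 2))) (fun m' =>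
  forall i j, i < n -> j < w -> exists c cs,
    [/\ m' (aD i j) = Z.of_nat (row_prod c j), c < n, size cs = l, all (fun c => c < n) cs &
        pairwise (fun a b => row_dist i c <= row_dist a b) (i :: cs)]).
Proof.
move=> l0; apply: (spec_seq (leqnn _) init_dists_ok) => m1 [F1 m1C m1T m1arr].
pose I k m' := same fixed m0 m' /\ exists cs ds nr c,
  [/\ size cs = l - k, c < n, m' rCUR = Z.of_nat c, forall i, i < n -> ds i <= ds c &
   [/\ greedy n q row_dist cs ds nr,
   forall i, i < n -> m' (aDs i) = Z.of_nat (ds i) /\ m' (aNr i) = Z.of_nat (nr i) &
   forall c j, c \in cs -> j < w -> m' (aD c j) = Z.of_nat (row_prod c j)]].
have n41 i : i < n -> (-40 - 2 * Z.of_nat n < aNr i /\ -40 - 2 * Z.of_nat n < aDs i)%Z by lia.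
apply: (@spec_seq _ _ _ _ _ _ _ (I 0) _ (leqnn _)).
  apply: (@spec_while _ _ _ _ l (w * (12 * q + 11) + 6 + (n * (12 * q + 24) + 5) + 2) _ I _ m1T).
  - by lia.
  - split=> //; exists [::], (fun=> q.+1), (fun=> 0), 0; split=> //; first by rewrite subnn.
    split=> //; first exact: greedy0.
    by move=> i /m1arr[-> ->]; split=> //; lia.
  move=> k m2 kl [F2 [cs [ds [nr [c [scs cn mC cmax [gr marr mD]]]]]]] m2T.
  have F2' : same (fun a => (-20 <= a <= -1)%Z) m0 m2 by move=> a Ha; apply: F2; left.
  apply: (@spec_blk_seq _ _ _ _ (w * (12 * q + 11) + 6 + (n * (12 * q + 24) + 5) + 1)).
    by simpl; lia.
  op (Z.of_nat k).
  set m3 := upd _ _ _.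
  have F3 : same (fun a => a <> rT) m2 m3 by move=> a Ha; rewrite /m3; rd.
  have F03 : same fixed m0 m3.
    by move=> a Ha; rewrite F3 ?F2 //; move: Ha; rewrite /fixed; lia.
  have m3T : m3 rT = Z.of_nat k by rewrite /m3; rd.
  move: m3 F3 F03 m3T => m3 F3 F03 m3T.
  have m3C : m3 rCUR = Z.of_nat c by rd.
  apply: (@spec_seq _ _ _ _ _ (n * (12 * q + 24) + 5 + 1) _ _ _ _
    (fill_row_ok F03 cn m3C)); first lia.
  move=> m4 [F4 m4D].
  have F34 a : (a < -40 \/ a = -40 \/ a = rCUR \/ a = rT \/ fixed a)%Z -> m4 a = m3 a.
    move=> Ha; apply: F4; rewrite /prodreg; split; first by move: Ha; rewrite /fixed; lia.
    by move=> j jw; have := aDcol cn jw; have := aDrow cn; move: Ha; rewrite /fixed; lia.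
  have F04 : same fixed m0 m4.
    by move=> a Ha; rewrite F34; [exact: F03|move: Ha; rewrite /fixed; lia].
  have m4T : m4 rT = Z.of_nat k by rewrite F34; [|lia].
  have m4C : m4 rCUR = Z.of_nat c by rewrite F34; [|lia].
  have m4arr i : i < n -> [/\ m4 (aDs i) = Z.of_nat (ds i), m4 (aNr i) = Z.of_nat (nr i) &
     ds i <= q.+1].
    move=> ip; have [d1 d2] := marr i ip; split.
    - by rewrite F34; [rewrite F3 //; lia|lia].
    - by rewrite F34; [rewrite F3 //; lia|lia].
    case: (greedy_ds gr ip) => [->//|[_ ->]].
    by rewrite /row_dist (leq_trans (sum_bits_le _ _ _)) // subn0.
  apply: (spec_seq _ (update_ok F04 cn m4C m4arr)); first exact: leqnn.
  move=> m5 [F5 m5arr [x [xn m5N m5x]]].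
  have F05 : same fixed m0 m5.
    by move=> a Ha; rewrite F5 ?F04 //; move: Ha; rewrite /upreg /fixed; lia.
  have m5ZERO : m5 rZERO = 0%Z by rewrite F05 ?m0ZERO //; left; lia.
  have m5T : m5 rT = Z.of_nat k by rewrite F5 ?m4T // /upreg; lia.
  apply: spec_blk => //.
  op (Z.of_nat x).
  split; first by rd.
  split; first by move=> a Ha; rewrite upd_neq; [exact: F05|move: Ha; rewrite /fixed; lia].
  exists (c :: cs), (upds c ds), (upnr c ds nr), x; split=> //; first by simpl; lia.
  split; first exact: greedy_step.
  - by move=> i ip; have [d1 d2] := m5arr i ip; split; rd.
  move=> c' j; rewrite inE => ccs jw.
  have cn' : c' < n.
    by case/orP: ccs => [/eqP->//|]; exact: (allP (greedy_lt gr)).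
  have [? ?] := aDrow cn'; have [? ?] := aDcol cn' jw.
  rewrite upd_neq; last lia.
  rewrite F5; last by rewrite /upreg; lia.
  (* The row of the current center, possibly a repeated one, has just been filled; the rows of other
     centers are untouched by [dinj]. *)
  case: (eqVneq c' c) ccs => [-> _|ne]; first exact: m4D.
  rewrite orFb => ccs.
  rewrite F4; first by rewrite F3 ?mD //; lia.
  split; first by rewrite /prodreg; lia.
  by move=> j' jw' E; case: (dinj cn' jw cn jw' E) => /eqP; rewrite (negPf ne).
move=> m2 [F2 [cs [ds [nr [c [scs cn mC cmax [gr marr mD]]]]]]].
rewrite subn0 in scs.
have cs0 : 0 < size cs by rewrite scs.
(* The initial value q + 1 cannot remain: there is a center, and [ds i] is at most its distance,
   which is at most q. *)
have near i : i < n -> nr i \in cs /\ ds i = row_dist i (nr i).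
  move=> ip; case: (greedy_ds gr ip) => // dsi; exfalso.
  case: cs cs0 gr {mD scs} => // c' cs _ gr.
  have /andP[+ _] := greedy_min gr ip.
  by rewrite dsi /row_dist => /leq_trans/(_ (sum_bits_le _ _ _)); rewrite subn0 ltnn.
have nrn i : i < n -> nr i < n by case/near => /(allP (greedy_lt gr)).
apply: spec_weaken (leqnn _) _ (@copy_rows_ok m2 cs nr F2 _ mD _).
- move=> m' H i j ip jw; exists (nr i), cs; split=> //; [exact: H|exact: nrn|exact: greedy_lt gr|].
  have [_ e] := near i ip; rewrite -e.
  by rewrite /= (greedy_min gr ip) (greedy_pack gr ip).
- by move=> i ip; have [? _] := near i ip; have [_ ?] := marr i ip; split=> //; exact: nrn.
(* A center is at distance 0 from itself, hence from its recorded nearest center; the two have equal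
   coordinates and equal products. *)
move=> c' j ccs jw; have cn' : c' < n by exact: (allP (greedy_lt gr)).
split=> //; have [_ e] := near c' cn'.
have hxx : row_dist c' c' = 0 by rewrite /row_dist big1 // => h _; rewrite /= eqxx.
have := allP (greedy_min gr cn') _ ccs; rewrite hxx leqn0 e => /eqP/eqP.
rewrite /row_dist sum_nat_seq_eq0 => /allP eqX.
apply: eq_big_nat => h hq; congr (nat_of_bool (_ && _)).
have := eqX h; rewrite mem_index_iota hq => /(_ isT) /=.
by rewrite eqb0 negbK => /eqP.
Qed.

End NonemptyPoints.

Lemma guarded_main_ok : 0 < l -> w <= n ->
  (forall i j, i < n -> j < w -> m0 (aD i j) = 0%Z) ->
  spec W (If rQ main) m0 (200 * (n * q * l + n * w) + 1) (fun m' =>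
  forall i j, i < n -> j < w -> exists c cs,
    [/\ m' (aD i j) = Z.of_nat (row_prod c j), c < n, size cs = l, all (fun c => c < n) cs &
        pairwise (fun a b => row_dist i c <= row_dist a b) (i :: cs)]).
Proof.
move=> l0 wn m0D; rewrite addn1; apply: spec_if; rewrite m0Q => q0.
  have {}q0 : q = 0 by lia.
  have hm0 a b : row_dist a b = 0 by rewrite /row_dist big_geq // q0.
  (* Without coordinates all distances and products are 0, so any l centers will do and the blank
     output is exact. *)
  move=> i j ip jw; exists i, (nseq l i); split=> //.
  - by rewrite m0D // /row_prod big_geq // q0.
  - by rewrite size_nseq.
  - by rewrite all_nseq ip orbT.
  by apply/(pairwiseP 0) => a b _ _ _; rewrite hm0.
have {}q0 : 0 < q by lia.
apply: spec_weaken (main_ok q0 l0) => //.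
(* Since n, q and l are positive and w is at most n, these bounds absorb all lower terms: the cost
   is at most 104 nql + 8 nw, within the constant 200. *)
have h1 : w * q * l <= n * q * l by rewrite !leq_mul.
have h2 : n * 1 * l <= n * q * l by rewrite !leq_mul.
have h3 : w * 1 * l <= n * 1 * l by rewrite !leq_mul.
have h4 : 1 * 1 * l <= n * 1 * l by rewrite !leq_mul.
have h5 : n * 1 * 1 <= n * 1 * l by rewrite !leq_mul.
lia.
Qed.

End Program.

(** * From packings to the additive error, and the input layout *)

(** The list [i :: cs] is the packing of l + 1 points given to [packing_lambda]; the absolute value
    takes [inner_prod_dist] in both directions. *)
Lemma greedy_error n q l (x : 'I_n -> point q) (X Y : nat -> nat -> bool)
    (i : 'I_n) c j (cs : seq nat) :
  (forall (a : 'I_n) (h : 'I_q), X a h = x a h) -> 0 < l -> c < n -> size cs = l ->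
  all (fun c => c < n) cs ->
  pairwise (fun a b => row_dist q X i c <= row_dist q X a b) ((i : nat) :: cs) ->
  (Z.abs (Z.of_nat (row_prod q X Y i j) - Z.of_nat (row_prod q X Y c j)) <=
   Z.of_nat (2 * lambda_pts x l))%Z.
Proof.
move=> eX l0 cn scs lcs pw.
have hmE (a b : 'I_n) : row_dist q X a b = ham (x a) (x b).
  by rewrite ham_sum /row_dist big_mkord; apply: eq_bigr => h _; rewrite /= !eX.
have dl : row_dist q X i c <= 2 * lambda_pts x l.
  pose s := [seq insubd i a | a <- (i : nat) :: cs].
  apply: (@packing_lambda n q l x s) => //; first by rewrite size_map -scs.
  rewrite pairwise_map; apply: (@sub_in_pairwise nat (fun a => a < n) _ _ _ _ _ pw); last first.
    by rewrite /= ltn_ord.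
  by move=> a b an bn /=; rewrite -hmE !val_insubd (an : a < n) (bn : b < n).
have d1 := inner_prod_dist q (X i) (X c) (Y j).
have d2 := inner_prod_dist q (X c) (X i) (Y j).
have d3 : \sum_(0 <= h < q) (X c h != X i h) = row_dist q X i c.
  by apply: eq_bigr => h _; rewrite /= eq_sym.
rewrite d3 in d2.
move: d1 d2; rewrite -/(row_dist q X i c) -/(row_prod q X Y i j) -/(row_prod q X Y c j); lia.
Qed.

(** Indexing by [nat] frees the reasoning about addresses from ordinals. *)
Definition mxbit p q (A : 'M[bool]_(p, q)) (i h : nat) : bool :=
  match (insub i : option 'I_p), (insub h : option 'I_q) with
  | Some i', Some h' => A i' h'
  | _, _ => false
  end.

Lemma mxbitE p q (A : 'M[bool]_(p, q)) (i : 'I_p) (h : 'I_q) : mxbit A i h = A i h.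
Proof. by rewrite /mxbit !valK. Qed.

Lemma entryZE p q (A : 'M[bool]_(p, q)) i h : entryZ A i h = Z.of_nat (mxbit A i h).
Proof. by rewrite /entryZ /mxbit; do 2 case: insub => [?|] //; case: (A _ _). Qed.

Lemma init_mem_A p q r (A : 'M[bool]_(p, q)) (B : 'M[bool]_(q, r)) s i h :
  i < p -> h < q ->
  (4 <= 4 + Z.of_nat i * Z.of_nat q + Z.of_nat h < baseB p q)%Z /\
  init_mem A B s (4 + Z.of_nat i * Z.of_nat q + Z.of_nat h) = Z.of_nat (mxbit A i h).
Proof.
move=> ip hq; rewrite /baseB /baseA.
have b : i * q + h < p * q.
  apply: (@leq_trans (i * q + q)); first by rewrite ltn_add2l.
  by rewrite addnC -mulSn leq_mul2r ip orbT.
split; first lia.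
rewrite /init_mem /baseB /baseA.
rewrite !(proj2 (Z.eqb_neq _ _)); try lia.
rewrite ifT; last by apply/andP; split; [apply/Z.leb_le|apply/Z.ltb_lt]; lia.
set o := Z.to_nat _.
have -> : o = i * q + h by rewrite /o; lia.
have q0 : 0 < q by lia.
by rewrite divnMDl // modnMDl divn_small // modn_small // addn0 entryZE.
Qed.

Lemma init_mem_B p q r (A : 'M[bool]_(p, q)) (B : 'M[bool]_(q, r)) s h j :
  h < q -> j < r ->
  (4 <= baseB p q + Z.of_nat h * Z.of_nat r + Z.of_nat j < baseD p q r)%Z /\
  init_mem A B s (baseB p q + Z.of_nat h * Z.of_nat r + Z.of_nat j) = Z.of_nat (mxbit B h j).
Proof.
move=> hq jr; rewrite /baseD /baseB /baseA.
have b : h * r + j < q * r.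
  apply: (@leq_trans (h * r + r)); first by rewrite ltn_add2l.
  by rewrite addnC -mulSn leq_mul2r hq orbT.
split; first lia.
rewrite /init_mem /baseD /baseB /baseA.
rewrite !(proj2 (Z.eqb_neq _ _)); try lia.
rewrite ifF; last by rewrite (proj2 (Z.ltb_ge _ _)) ?andbF //; lia.
rewrite ifT; last by apply/andP; split; [apply/Z.leb_le|apply/Z.ltb_lt]; lia.
set o := Z.to_nat _.
have -> : o = h * r + j by rewrite /o; lia.
have r0 : 0 < r by lia.
by rewrite divnMDl // modnMDl divn_small // modn_small // addn0 entryZE.
Qed.

Lemma init_mem_beyond p q r (A : 'M[bool]_(p, q)) (B : 'M[bool]_(q, r)) s a :
  (baseD p q r <= a \/ a < 0)%Z -> init_mem A B s a = 0%Z.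
Proof.
rewrite /baseD /baseB /baseA => Ha; rewrite /init_mem /baseD /baseB /baseA.
rewrite !(proj2 (Z.eqb_neq _ _)); try lia.
rewrite ifF; last by case: Z.leb_spec; case: Z.ltb_spec; lia.
by rewrite ifF //; case: Z.leb_spec; case: Z.ltb_spec; lia.
Qed.

Lemma prod_entry_row_prod p q r (A : 'M[bool]_(p, q)) (B : 'M[bool]_(q, r)) i j :
  prod_entry A B i j = row_prod q (mxbit A) (fun j h => mxbit B h j) i j.
Proof.
rewrite /row_prod big_mkord; apply: eq_bigr => h _; by rewrite !mxbitE /inner_val mulnb.
Qed.

Lemma prod_entry_row_prod_sym p q r (A : 'M[bool]_(p, q)) (B : 'M[bool]_(q, r)) i j :
  prod_entry A B i j = row_prod q (fun j h => mxbit B h j) (mxbit A) j i.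
Proof.
by rewrite /row_prod big_mkord; apply: eq_bigr => h _; rewrite !mxbitE /inner_val mulnb andbC.
Qed.

Lemma index_inj r i j i' j' : j < r -> j' < r ->
  i * r + j = i' * r + j' -> i = i' /\ j = j'.
Proof.
move=> jr jr' E; have r0 : 0 < r by lia.
split; first by move/(congr1 (divn^~ r)): E; rewrite !divnMDl // !divn_small // !addn0.
by move/(congr1 (modn^~ r)): E; rewrite !modnMDl !modn_small.
Qed.

(** * Word size, setup code and the two parts *)

(** Source of the exponent 8: 128 is 2 ^ 7, and the summand 2 in [insize] ensures s >= 2. The factor
    128 leaves room for the constants in addresses even on the smallest inputs. *)
Lemma word_bound s : 2 <= s -> 128 * s <= s ^ 8.
Proof.
move=> s2; rewrite expnSr leq_mul2r; apply/orP; right.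
by rewrite (@leq_exp2r 2 s 7).
Qed.

(** [rZERO] needs no initialization, as cells outside the input start at 0; adding it turns [IAdd]
    into a move. The bases of A and B are left in [r2] and [r1] for the strides set next. *)
Definition setup : seq instr :=
  [:: IConst rONE 1; IAdd rQ 1 rZERO; IAdd rL 3 rZERO; IConst r2 4; IMul r1 0 1;
      IAdd r1 r2 r1; IMul r3 1 2; IAdd rBD r1 r3].

Definition setup_rows : seq instr :=
  [:: IAdd rN 0 rZERO; IAdd rR 2 rZERO; IAdd rBX r2 rZERO; IAdd rSI 1 rZERO;
      IAdd rSH rONE rZERO; IAdd rBY r1 rZERO; IAdd rTJ rONE rZERO; IAdd rTH 2 rZERO;
      IAdd rDI 2 rZERO; IAdd rDJ rONE rZERO].

Definition setup_cols : seq instr :=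
  [:: IAdd rN 2 rZERO; IAdd rR 0 rZERO; IAdd rBX r1 rZERO; IAdd rSI rONE rZERO;
      IAdd rSH 2 rZERO; IAdd rBY r2 rZERO; IAdd rTJ 1 rZERO; IAdd rTH rONE rZERO;
      IAdd rDI rONE rZERO; IAdd rDJ 2 rZERO].

(* For q = 0 a single pass over the points may exceed the O(pql + pr) budget, but
   then the output is the initial 0. *)
Definition program (setup' : seq instr) : cmd := Seq (Blk (setup ++ setup')) (If rQ main).

Lemma insize_word p q r s :
  (128 * (Z.of_nat p + Z.of_nat q + Z.of_nat r + Z.of_nat s +
    Z.of_nat p * Z.of_nat q + Z.of_nat q * Z.of_nat r + Z.of_nat p * Z.of_nat r + 2) <=
   Z.of_nat (insize p q r s ^ 8))%Z.
Proof.
have /word_bound : 2 <= insize p q r s by rewrite /insize; lia.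
by move: (_ ^ 8) => w; rewrite /insize; lia.
Qed.

Lemma baseDE p q r :
  baseD p q r = (4 + Z.of_nat p * Z.of_nat q + Z.of_nat q * Z.of_nat r)%Z.
Proof. by rewrite /baseD /baseB /baseA; lia. Qed.

Lemma setup_ok p q r s (A : 'M[bool]_(p, q)) (B : 'M[bool]_(q, r)) setup' Q :
  (forall m, [/\ m 0%Z = Z.of_nat p, m 1%Z = Z.of_nat q, m 2%Z = Z.of_nat r,
      m rQ = Z.of_nat q & m rL = Z.of_nat s] ->
    [/\ m rONE = 1%Z, m rZERO = 0%Z, m r2 = 4%Z,
      m r1 = (4 + Z.of_nat p * Z.of_nat q)%Z & m rBD = baseD p q r] ->
    same (fun a => 4 <= a)%Z (init_mem A B s) m ->
    blk (Z.of_nat (insize p q r s ^ 8)) setup' m Q) ->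
  blk (Z.of_nat (insize p q r s ^ 8)) (setup ++ setup') (init_mem A B s) Q.
Proof.
have := @insize_word p q r s; set W := Z.of_nat (_ ^ 8); set m := init_mem A B s => bW H.
have pq0 : (0 <= Z.of_nat p * Z.of_nat q)%Z by lia.
have qr0 : (0 <= Z.of_nat q * Z.of_nat r)%Z by lia.
have pr0 : (0 <= Z.of_nat p * Z.of_nat r)%Z by lia.
have mp : m 0%Z = Z.of_nat p by [].
have mq : m 1%Z = Z.of_nat q by [].
have mr : m 2%Z = Z.of_nat r by [].
have ml : m 3%Z = Z.of_nat s by [].
have mZ : m rZERO = 0%Z by apply: init_mem_beyond; lia.
have F : same (fun a => 4 <= a)%Z (init_mem A B s) m by [].
rewrite baseDE in H; clearbody m; rewrite /setup cat_cons.
op 1%Z.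
op (Z.of_nat q).
op (Z.of_nat s).
op 4%Z.
op (Z.of_nat p * Z.of_nat q)%Z.
op (4 + Z.of_nat p * Z.of_nat q)%Z.
op (Z.of_nat q * Z.of_nat r)%Z.
op (4 + Z.of_nat p * Z.of_nat q + Z.of_nat q * Z.of_nat r)%Z.
apply: H; try (by split; rd).
by move=> a Ha; rewrite !upd_neq ?F //; lia.
Qed.

Lemma rows_correct p q r l (A : 'M[bool]_(p, q)) (B : 'M[bool]_(q, r)) :
  1 <= l <= p -> r <= p ->
  exists m', run (Z.of_nat (insize p q r l ^ 8)) (compile 0 (program setup_rows))
      (200 * (p * q * l + p * r) + 200) 0 (init_mem A B l) = Some m' /\
    forall (i : 'I_p) (j : 'I_r),
      (Z.abs (Z.of_nat (prod_entry A B i j) - out_entry q m' i j) <=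
       Z.of_nat (2 * lambda_row A l))%Z.
Proof.
move=> /andP[l0 lp] rp.
suff /run_spec[m' [E H]] : spec (Z.of_nat (insize p q r l ^ 8)) (program setup_rows)
    (init_mem A B l) (200 * (p * q * l + p * r) + 199)
    (fun m' => forall i j, i < p -> j < r -> exists c cs,
    [/\ m' (baseD p q r + Z.of_nat i * Z.of_nat r + Z.of_nat j * 1)%Z =
          Z.of_nat (row_prod q (mxbit A) (fun j h => mxbit B h j) c j),
        c < p, size cs = l, all (fun c => c < p) cs &
        pairwise (fun a b => row_dist q (mxbit A) i c <= row_dist q (mxbit A) a b) (i :: cs)]).
  exists m'; split; first by rewrite -E addnS.
  move=> i j; have [c [cs [Em cp scs lcs pw]]] := H i j (ltn_ord i) (ltn_ord j).
  have -> : out_entry q m' i j = Z.of_nat (row_prod q (mxbit A) (fun j h => mxbit B h j) c j).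
    by rewrite -Em /out_entry; congr m'; lia.
  rewrite prod_entry_row_prod -[lambda_row A l]/(lambda_pts (rowpt A) l).
  apply: (@greedy_error p q l (rowpt A) (mxbit A) _ i c j cs _ l0 cp scs lcs pw).
  by move=> a h; rewrite mxbitE ffunE.
apply: (@spec_blk_seq _ _ _ _ (200 * (p * q * l + p * r) + 1)).
  by have -> : size (setup ++ setup_rows) = 18 by []; lia.
apply: setup_ok => m [mp mq mr mQ mL] [mONE mZ m2 m1 mBD] F.
have := @insize_word p q r l; set W := Z.of_nat (_ ^ 8) => bW.
have pq0 : (0 <= Z.of_nat p * Z.of_nat q)%Z by lia.
have qr0 : (0 <= Z.of_nat q * Z.of_nat r)%Z by lia.
have pr0 : (0 <= Z.of_nat p * Z.of_nat r)%Z by lia.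
rewrite /setup_rows.
op (Z.of_nat p).
op (Z.of_nat r).
op 4%Z.
op (Z.of_nat q).
op 1%Z.
op (4 + Z.of_nat p * Z.of_nat q)%Z.
op 1%Z.
op (Z.of_nat r).
op (Z.of_nat r).
op 1%Z.
have eD := baseDE p q r; have eB : baseB p q = (4 + Z.of_nat p * Z.of_nat q)%Z.
  by rewrite /baseB /baseA; lia.
apply: (@guarded_main_ok W p q r l _ _ _ 4 (Z.of_nat q) 1
   (4 + Z.of_nat p * Z.of_nat q) 1 (Z.of_nat r) (baseD p q r) (Z.of_nat r) 1);
   try (by rd); try lia.
- move=> i h ip hq; have [] := init_mem_A A B l ip hq; rewrite eB Z.mul_1_r => b E.
  by split; [lia|rd].
- move=> j h jr hq; have [] := init_mem_B A B l hq jr; rewrite eB Z.mul_1_r.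
  rewrite -!Z.add_assoc [(Z.of_nat h * _ + _)%Z]Z.add_comm => b E.
  by split; [lia|rd].
- move=> i j i' j' ip jr ip' jr' E; apply: index_inj jr jr' _; lia.
move=> i j ip jr; have ir0 : (0 <= Z.of_nat i * Z.of_nat r)%Z by lia.
by rewrite !upd_neq ?F ?init_mem_beyond //; lia.
Qed.

Lemma cols_correct p q r k (A : 'M[bool]_(p, q)) (B : 'M[bool]_(q, r)) :
  1 <= k <= r -> p <= r ->
  exists m', run (Z.of_nat (insize p q r k ^ 8)) (compile 0 (program setup_cols))
      (200 * (r * q * k + p * r) + 200) 0 (init_mem A B k) = Some m' /\
    forall (i : 'I_p) (j : 'I_r),
      (Z.abs (Z.of_nat (prod_entry A B i j) - out_entry q m' i j) <=
       Z.of_nat (2 * lambda_col B k))%Z.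
Proof.
move=> /andP[k0 kr] le_pr.
suff /run_spec[m' [E H]] : spec (Z.of_nat (insize p q r k ^ 8)) (program setup_cols)
    (init_mem A B k) (200 * (r * q * k + r * p) + 199)
    (fun m' => forall j i, j < r -> i < p -> exists c cs,
    [/\ m' (baseD p q r + Z.of_nat j * 1 + Z.of_nat i * Z.of_nat r)%Z =
          Z.of_nat (row_prod q (fun j h => mxbit B h j) (mxbit A) c i),
        c < r, size cs = k, all (fun c => c < r) cs &
        pairwise (fun a b => row_dist q (fun j h => mxbit B h j) j c <=
                             row_dist q (fun j h => mxbit B h j) a b) (j :: cs)]).
  exists m'; split; first by rewrite -E addnS [r * p]mulnC.
  move=> i j; have [c [cs [Em cp scs lcs pw]]] := H j i (ltn_ord j) (ltn_ord i).
  have -> : out_entry q m' i j = Z.of_nat (row_prod q (fun j h => mxbit B h j) (mxbit A) c i).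
    by rewrite -Em /out_entry; congr m'; lia.
  rewrite prod_entry_row_prod_sym -[lambda_col B k]/(lambda_pts (colpt B) k).
  apply: (@greedy_error r q k (colpt B) (fun j h => mxbit B h j) _ j c i cs _ k0 cp scs lcs pw).
  by move=> a h; rewrite mxbitE ffunE.
apply: (@spec_blk_seq _ _ _ _ (200 * (r * q * k + r * p) + 1)).
  by have -> : size (setup ++ setup_cols) = 18 by []; lia.
apply: setup_ok => m [mp mq mr mQ mL] [mONE mZ m2 m1 mBD] F.
have := @insize_word p q r k; set W := Z.of_nat (_ ^ 8) => bW.
have pq0 : (0 <= Z.of_nat p * Z.of_nat q)%Z by lia.
have qr0 : (0 <= Z.of_nat q * Z.of_nat r)%Z by lia.
have pr0 : (0 <= Z.of_nat p * Z.of_nat r)%Z by lia.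
rewrite /setup_cols.
op (Z.of_nat r).
op (Z.of_nat p).
op (4 + Z.of_nat p * Z.of_nat q)%Z.
op 1%Z.
op (Z.of_nat r).
op 4%Z.
op (Z.of_nat q).
op 1%Z.
op 1%Z.
op (Z.of_nat r).
have eD := baseDE p q r; have eB : baseB p q = (4 + Z.of_nat p * Z.of_nat q)%Z.
  by rewrite /baseB /baseA; lia.
apply: (@guarded_main_ok W r q p k _ _ _ (4 + Z.of_nat p * Z.of_nat q) 1 (Z.of_nat r)
   4 (Z.of_nat q) 1 (baseD p q r) 1 (Z.of_nat r)); try (by rd); try lia.
- move=> j h jr hq; have [] := init_mem_B A B k hq jr; rewrite eB Z.mul_1_r.
  rewrite -!Z.add_assoc [(Z.of_nat h * _ + _)%Z]Z.add_comm => b E.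
  by split; [lia|rd].
- move=> i h ip hq; have [] := init_mem_A A B k ip hq; rewrite eB Z.mul_1_r => b E.
  by split; [lia|rd].
- move=> j i j' i' jr ip jr' ip' E.
  by have [|-> ->] := @index_inj r i j i' j' jr jr'; first lia.
move=> j i jr ip; have ir0 : (0 <= Z.of_nat i * Z.of_nat r)%Z by lia.
by rewrite !upd_neq ?F ?init_mem_beyond //; lia.
Qed.

Theorem theorem1 :
  (* (1) p >= r : error <= 2 lambda(A, l, row), time O(pql + pr) *)
  (exists (P : seq instr) (c e : nat),
     forall (p q r l : nat) (A : 'M[bool]_(p, q)) (B : 'M[bool]_(q, r)),
       (1 <= l <= p)%N -> (r <= p)%N ->
       exists m' : Z -> Z,
         run (Z.of_nat (insize p q r l ^ e)) P (c * (p * q * l + p * r) + c)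
             0 (init_mem A B l) = Some m' /\
         forall (i : 'I_p) (j : 'I_r),
           Z.le (Z.abs (Z.sub (Z.of_nat (prod_entry A B i j)) (out_entry q m' i j)))
                (Z.of_nat (2 * lambda_row A l)))
  /\
  (* (2) p <= r : error <= 2 lambda(B, k, col), time O(rqk + pr) *)
  (exists (P : seq instr) (c e : nat),
     forall (p q r k : nat) (A : 'M[bool]_(p, q)) (B : 'M[bool]_(q, r)),
       (1 <= k <= r)%N -> (p <= r)%N ->
       exists m' : Z -> Z,
         run (Z.of_nat (insize p q r k ^ e)) P (c * (r * q * k + p * r) + c)
             0 (init_mem A B k) = Some m' /\
         forall (i : 'I_p) (j : 'I_r),
           Z.le (Z.abs (Z.sub (Z.of_nat (prod_entry A B i j)) (out_entry q m' i j)))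
                (Z.of_nat (2 * lambda_col B k))).
Proof.
split; [exists (compile 0 (program setup_rows))|exists (compile 0 (program setup_cols))];
  exists 200, 8.
- exact: rows_correct.
- exact: cols_correct.
Qed.
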